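(* Let $c$ be a constant with $0<c<1/2$. Then the diameter of a random Cayley digraph on an elementary abelian $2$-group of order $n$ and degree $\lfloor cn\rfloor$ is asymptotically almost surely equal to two, and the convergence is exponentially fast. That is, there exist constants $C>0$ and $\delta>0$ (depending only on $c$) such that for every $n=2^d$ ($d\ge 1$) with $k:=\lfloor cn\rfloor\ge 1$, if $G\cong \mathbb{Z}_2^d$ and $S$ is a uniformly random $k$-element subset of $G\setminus\{1\}$, then $$\Pr\big(\operatorname{diam}(\operatorname{Cay}(G,S))\neq 2\big)\le C e^{-\delta n}.$$
   Context: For a finite group $G$ and a subset $S\subseteq G\setminus\{1\}$, the Cayley digraph $\operatorname{Cay}(G,S)$ has vertex set $G$ and arc set $\{(g,gs): g\in G, s\in S\}$. The distance from $g$ to $h$ is the length of the shortest directed path from $g$ to $h$ (infinite if there is none). The diameter $\operatorname{diam}(\operatorname{Cay}(G,S))$ is the smallest integer $d$ such that for every ordered pair $(g,h)$ the distance from $g$ to $h$ is at most $d$ (and is $\infty$ if no such $d$ exists). A random Cayley digraph on $G$ of degree $k$, $1\le k\le |G|-1$, is $\operatorname{Cay}(G,S)$ with $S$ chosen uniformly among all $k$-element subsets of $G\setminus\{1\}$. *)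

(* Defs.v *)
From mathcomp Require Import all_boot all_order all_algebra all_fingroup all_solvable.
From mathcomp Require Import boolp reals.

Set Implicit Arguments.
Unset Strict Implicit.
Unset Printing Implicit Defensive.

Import Order.TTheory GRing.Theory Num.Theory.

Section Digraph.
Variables (T : finType) (e : rel T).

Definition has_walk (x y : T) (m : nat) : bool :=
  [exists p : m.-tuple T, path e x p && (last x p == y)].

(* Distances and diameters live in option nat, with None for infinity. *)
Definition distance (x y : T) : option nat :=
  if pselect (exists m, has_walk x y m) is left ex_m then Some (ex_minn ex_m)
  else None.

Definition distance_le (x y : T) (d : nat) : bool :=
  if distance x y is Some m then m <= d else false.

Definition diam : option nat :=
  if pselect (exists d, [forall x, forall y, distance_le x y d]) is left ex_d
  then Some (ex_minn ex_d)
  else None.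

End Digraph.

Section Cayley.
Variable gT : finGroupType.

Definition Cay (S : {set gT}) : rel gT :=
  fun g h => [exists s in S, h == (g * s)%g].

Definition connection_sets (k : nat) : {set {set gT}} :=
  [set S : {set gT} | (S \subset [set~ 1%g]) && (#|S| == k)].

(* Meaningful when k < #|gT|, so that connection_sets k is nonempty. *)
Definition Pr_connection_set (R : realType) (k : nat) (E : pred {set gT}) : R :=
  (#|[set S in connection_sets k | E S]|%:R / #|connection_sets k|%:R)%R.

End Cayley.

(* Main.v *)
(* In an elementary abelian 2-group of order n, an element g <> 1 is a product
   of two elements of S unless S is shift-free: disjoint from S g.  Extending a
   shift-free j-set S to a shift-free (j+1)-set leaves at most n - 2j choices
   for the new element, which must avoid S and S g, against n - 1 - j choices
   for an arbitrary subset of G \ {1}.  The ratio of these is at most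
   exp(-(j-1)/n), so a random k-set is shift-free for a given g with probability
   at most exp(-(k-1)(k-2)/(2n)), roughly exp(-c^2 n/2); a union bound over g
   costs a factor n. *)
Require Import Defs.
From mathcomp Require Import all_boot all_order all_algebra all_fingroup all_solvable.
From mathcomp Require Import boolp reals sequences exp.
From mathcomp Require Import zify ring lra.

Set Implicit Arguments.
Unset Strict Implicit.
Unset Printing Implicit Defensive.

Import Order.TTheory GRing.Theory Num.Theory.
Local Open Scope ring_scope.

Lemma distance_leP (T : finType) (e : rel T) x y d :
  reflect (exists2 m, (m <= d)%N & has_walk e x y m) (distance_le e x y d).
Proof.
rewrite /distance_le /distance; case: pselect => [ex_m|no_m].
  case: ex_minnP => m walk_m min_m; apply: (iffP idP) => [le_md|]; first by exists m.
  by case=> m' le_m'd /min_m /leq_trans; apply.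
by constructor=> -[m _ walk_m]; apply: no_m; exists m.
Qed.

Lemma diam_eq_Some (T : finType) (e : rel T) d :
    (forall x y, distance_le e x y d.+1) ->
    (exists x y, ~~ distance_le e x y d) ->
  diam e = Some d.+1.
Proof.
move=> far [x [y far_xy]]; rewrite /diam; case: pselect => [ex_d|[]]; last first.
  by exists d.+1; apply/forallP=> u; apply/forallP=> v.
congr Some; case: ex_minnP => m /forallP bound_m min_m.
apply/eqP; rewrite eqn_leq min_m /=; last first.
  by apply/forallP=> u; apply/forallP=> v.
rewrite ltnNge; apply/negP=> le_md.
have /forallP/(_ y)/distance_leP[l le_lm walk_l] := bound_m x.
by case/negP: far_xy; apply/distance_leP; exists l => //; apply: leq_trans le_md.
Qed.

Section CayleyDiameter.
Variable gT : finGroupType.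
Implicit Types (S : {set gT}) (g : gT).

Lemma CayE S g h : Cay S g h = ((g^-1 * h)%g \in S).
Proof.
apply/existsP/idP => [[s /andP[Ss /eqP->]]|Sgh]; first by rewrite mulKg.
by exists (g^-1 * h)%g; rewrite Sgh mulKVg eqxx.
Qed.

(** Writing x^-1 y as a product of two elements of [S] gives a walk of length two from x to y.
    Properness leaves some [g != 1] outside [S], which no walk of length at most one from 1
    reaches. *)
Lemma diam_Cay_eq2 S :
    S \proper [set~ 1%g] ->
    (forall g, g != 1%g -> exists2 s, s \in S & (s^-1 * g)%g \in S) ->
  diam (Cay S) = Some 2%N.
Proof.
move=> /properP[_ [g]]; rewrite !inE => g_neq1 SNg prodS.
apply: diam_eq_Some => [x y|].
  apply/distance_leP; have [->|xy_neq] := eqVneq x y.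
    by exists 0%N => //; apply/existsP; exists [tuple]; rewrite /= eqxx.
  have [|s Ss St] := prodS (x^-1 * y)%g.
    by apply: contra_neq xy_neq => /(congr1 (mulg x)); rewrite mulKVg mulg1.
  exists 2%N => //; apply/existsP; exists [tuple (x * s)%g; y].
  by rewrite /= !CayE mulKg Ss invMg -mulgA St eqxx.
exists 1%g, g; apply/distance_leP => -[m le_m1 /existsP[p]].
case: m le_m1 p => [|[|//]] _ p.
  by rewrite tuple0 /= eq_sym (negbTE g_neq1).
case: p => -[|y []] //= _; rewrite CayE invg1 mul1g andbT => /andP[Sy /eqP y_g].
by rewrite y_g (negbTE SNg) in Sy.
Qed.

End CayleyDiameter.

(** Use 1 - k/n <= exp(-k/n): the product (n - k - 2)(1 - k/n) exceeds n - 2(k+1) by k(k+2)/n. When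
    n < 2(k+1) the truncated left side is 0. *)
Lemma shift_free_decay_factor (R : realType) (n k : nat) :
  (n - k.+1.*2)%:R <= (n.-1 - k.+1)%:R * expR (- (k%:R / n%:R)) :> R.
Proof.
have [le_kn|/ltnW] := leqP k.+1.*2 n; last first.
  by rewrite -subn_eq0 => /eqP->; rewrite mulr_ge0 ?expR_ge0.
apply: le_trans (ler_wpM2l (ler0n R _) (expR_ge1Dx _)).
rewrite -subn1 -subnDA !natrB //; last by lia.
have n_gt0 : 0 < n%:R :> R by rewrite ltr0n; lia.
rewrite -addnn natrD natrD -natr1.
have -> : (n%:R - (1 + (k%:R + 1))) * (1 - k%:R / n%:R) =
  n%:R - (k%:R + 1 + (k%:R + 1)) + k%:R * (k%:R + 2) / n%:R :> R.
  by field; rewrite gt_eqF.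
by rewrite lerDl divr_ge0 ?mulr_ge0 ?addr_ge0.
Qed.

Section ShiftFree.
Variable gT : finGroupType.
Implicit Types (S : {set gT}) (g x : gT) (k : nat).

Definition shift_free g S : bool := [disjoint S & (S :* g)%g].

Definition shift_free_sets k g : {set {set gT}} :=
  [set S in connection_sets gT k | shift_free g S].

Lemma card_connection_sets k : #|connection_sets gT k| = 'C(#|gT|.-1, k).
Proof. by rewrite cards_draws cardsC1. Qed.

Lemma shift_free_setD1 g x S :
    x \in S -> shift_free g S ->
  shift_free g (S :\ x) && (x \notin (S :\ x) :|: ((S :\ x) :* g)%g).
Proof.
move=> Sx freeS; have sub : S :\ x \subset S by apply: subD1set.
apply/andP; split.
  by apply: disjointW freeS => //; apply: mulSg.
rewrite !inE eqxx /=; apply: contraL freeS => xSg.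
apply/pred0Pn; exists x; rewrite /= Sx /=.
by apply: subsetP xSg; apply: mulSg.
Qed.

Lemma shift_free_cover g S k :
  S \in shift_free_sets k g -> #|S :|: (S :* g)%g| = k.*2.
Proof.
rewrite !inE => /andP[/andP[_ /eqP <-]]; rewrite /shift_free -setI_eq0 => /eqP disj.
by rewrite cardsU disj cards0 subn0 card_rcoset addnn.
Qed.

(* Double counting of the pairs (T, x) with x in T: removing x from T leaves a
   shift-free k-set S, and x lies outside the 2k elements of S and S g. *)
Lemma leq_card_shift_free_setsS k g :
  (k.+1 * #|shift_free_sets k.+1 g| <= (#|gT| - k.*2) * #|shift_free_sets k g|)%N.
Proof.
have -> : (k.+1 * #|shift_free_sets k.+1 g|)%N =
    \sum_(x : gT) #|[set T in shift_free_sets k.+1 g | x \in T]|.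
  rewrite mulnC -sum_nat_const.
  transitivity (\sum_(T in shift_free_sets k.+1 g) \sum_(x in T) 1)%N.
    by apply: eq_bigr => T; rewrite !inE sum1_card => /andP[/andP[_ /eqP ->]].
  rewrite (exchange_big_dep predT) //=; apply: eq_bigr => x _.
  by rewrite -sum1_card; apply: eq_bigl => T; rewrite !inE.
have -> : ((#|gT| - k.*2) * #|shift_free_sets k g|)%N =
    \sum_(x : gT) #|[set S in shift_free_sets k g | x \notin S :|: (S :* g)%g]|.
  rewrite mulnC -sum_nat_const.
  transitivity (\sum_(S in shift_free_sets k g)
                  \sum_(x | x \notin S :|: (S :* g)%g) 1)%N.
    apply: eq_bigr => S FS; rewrite -(shift_free_cover FS) -(cardsC (S :|: (S :* g)%g)).
    by rewrite addKn -sum1_card; apply: eq_bigl => x; rewrite inE.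
  rewrite (exchange_big_dep predT) //=; apply: eq_bigr => x _.
  by rewrite -sum1_card; apply: eq_bigl => S; rewrite !inE.
(* The two counts are compared for each fixed x: putting x back recovers T from [T :\ x], so the
   removal is injective. *)
apply: leq_sum => x _.
have injD1 : {in [set T in shift_free_sets k.+1 g | x \in T] &,
    injective (fun T : {set gT} => T :\ x)}.
  move=> T1 T2; rewrite inE => /andP[_ T1x]; rewrite inE => /andP[_ T2x] eqT.
  by rewrite -(setD1K T1x) eqT setD1K.
rewrite -(card_in_imset injD1); apply: subset_leq_card.
apply/subsetP=> _ /imsetP[T + ->].
rewrite inE => /andP[]; rewrite inE => /andP[]; rewrite inE => /andP[sT1 /eqP cT].
move=> freeT Tx; have /andP[free' xN] := shift_free_setD1 Tx freeT.
rewrite inE xN andbT inE free' andbT inE.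
rewrite (subset_trans (subD1set _ _) sT1) /=.
by move: cT; rewrite (cardsD1 x) Tx add1n => -[->].
Qed.

(** Induction from the trivial bound for singletons: passing from (k+1)-sets to (k+2)-sets gains a
    factor exp(-k/n) against all subsets, and 0 + 1 + ... + (k-1) = ['C(k, 2)]. *)
Lemma card_shift_free_sets_le (R : realType) k g :
  #|shift_free_sets k.+1 g|%:R <=
    expR (- ('C(k, 2)%:R / #|gT|%:R)) * #|connection_sets gT k.+1|%:R :> R.
Proof.
elim: k => [|k IHk].
  rewrite mul0r oppr0 expR0 mul1r ler_nat subset_leq_card //.
  by apply/subsetP=> S; rewrite inE => /andP[].
rewrite -(ler_pM2l (ltr0Sn R k.+1)) -natrM.
have := leq_card_shift_free_setsS k.+1 g; rewrite -(ler_nat R) => /le_trans; apply.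
(* Growth of the number of all sets: (k+2) C(n-1, k+2) = (n-1-(k+1)) C(n-1, k+1). *)
rewrite card_connection_sets mulrCA -(natrM _ k.+2) mul_bin_left !natrM.
apply: le_trans (ler_pM (ler0n _ _) (ler0n _ _) (shift_free_decay_factor R _ _) IHk) _.
rewrite card_connection_sets binS bin1 natrD mulrDl opprD expRD.
by rewrite le_eqVlt; apply/orP; left; apply/eqP; ring.
Qed.

End ShiftFree.

Lemma abelem2_diam_shift_free (gT : finGroupType) (k : nat) (S : {set gT}) :
    (2.-abelem [set: gT])%g -> (k < #|gT|.-1)%N ->
    S \in connection_sets gT k -> diam (Cay S) != Some 2%N ->
  [exists g, shift_free g S].
Proof.
move=> /abelemP[//|_ sq1] lt_k; rewrite inE => /andP[sS1 /eqP cS].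
apply: contraR => /existsPn not_free; apply/eqP; apply: diam_Cay_eq2.
  by rewrite properEcard sS1 cS cardsC1.
move=> g _; have /pred0Pn[x /= /andP[Sx]] := not_free g.
case/rcosetP=> s Ss def_x; exists s => //.
(* Squares are trivial, so s^-1 = s and s^-1 g is the common element x = s g. *)
have /eqP := sq1 s (in_setT s); rewrite -eq_invg_mul => /eqP ->.
by rewrite -def_x.
Qed.

Lemma Pr_diam_Cay_neq2 (R : realType) (gT : finGroupType) (k : nat) :
    (2.-abelem [set: gT])%g -> (k.+1 < #|gT|.-1)%N ->
  Pr_connection_set R k.+1 (fun S : {set gT} => diam (Cay S) != Some 2%N)
    <= #|gT|%:R * expR (- ('C(k, 2)%:R / #|gT|%:R)).
Proof.
move=> abelG lt_k; rewrite /Pr_connection_set.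
have conn_gt0 : 0 < #|connection_sets gT k.+1|%:R :> R.
  by rewrite ltr0n card_connection_sets bin_gt0 ltnW.
rewrite ler_pdivrMr // -mulrA.
apply: (@le_trans _ _ (\sum_(g : gT) #|shift_free_sets k.+1 g|%:R)); last first.
  rewrite [leRHS]mulr_natl -sumr_const.
  by apply: ler_sum => g _; apply: card_shift_free_sets_le.
rewrite -natr_sum ler_nat.
apply: (@leq_trans #|\bigcup_g shift_free_sets k.+1 g|).
  apply: subset_leq_card; apply/subsetP=> S; rewrite inE => /andP[connS dS].
  have /existsP[g freeS] := abelem2_diam_shift_free abelG lt_k connS dS.
  by apply/bigcupP; exists g => //; rewrite inE connS.
elim/big_rec2: _ => [|g m A _ leA]; first by rewrite cards0.
by apply: leq_trans (leq_card_setU _ _).1 _; rewrite leq_add2l.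
Qed.

Theorem theorem4p4 (R : realType) (c : R) (hc0 : 0 < c) (hc1 : c < 1 / 2) :
  exists C delta : R,
    [/\ 0 < C, 0 < delta &
      forall (gT : finGroupType) (d n k : nat),
        (1 <= d)%N -> n = (2 ^ d)%N ->
        (2.-abelem [set: gT])%g -> #|[set: gT]| = n ->
        k%:Z = Num.floor (c * n%:R) -> (1 <= k)%N ->
        Pr_connection_set R k (fun S : {set gT} => diam (Cay S) != Some 2%N)
          <= C * expR (- delta * n%:R)].
Proof.
have c2_gt0 : 0 < c ^+ 2 by rewrite exprn_gt0.
(* The exponent will be at least c^2 n/2 - 3. Half of its main term, x = c^2 n/4, absorbs the
   union-bound factor through n = (4/c^2) x <= (4/c^2) exp(x); the other half gives [delta]. *)
exists (4 / c ^+ 2 * expR 3), (c ^+ 2 / 4); split.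
- by rewrite mulr_gt0 ?expR_gt0 ?divr_gt0.
- by rewrite divr_gt0.
move=> gT d n [//|k] d_gt0 def_n abelG; rewrite cardsT => cG def_k _.
have n_ge2 : (2 <= n)%N by rewrite def_n -{1}(expn1 2) leq_exp2l.
have n_gt0 : 0 < n%:R :> R by rewrite ltr0n ltnW.
have [le_k lt_k] : k.+1%:R <= c * n%:R /\ c * n%:R < k.+1%:R + 1.
  have := floor_itv (c * n%:R); rewrite -def_k intrD => /andP[].
  by rewrite -!pmulrn.
(* Here c < 1/2 enters, through 2(k+1) <= 2cn < n. *)
have k_lt : (k.+1 < #|gT|.-1)%N.
  rewrite cG; have : (k.+1.*2 < n)%N.
    rewrite -(ltr_nat R) -muln2 natrM.
    have : c * n%:R < 1 / 2 * n%:R by rewrite ltr_pM2r.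
    lra.
  lia.
(* The degree is k+1, so cn < k+2. Then 2 C(k, 2) = (k+2)^2 - (5k+4) >= (cn)^2 - 6n, as 5k+4 <=
   6(k+1) <= 6n. *)
have exp_lb : c ^+ 2 / 2 * n%:R - 3 <= 'C(k, 2)%:R / n%:R :> R.
  rewrite ler_pdivlMr //.
  have bin2R : 'C(k, 2)%:R *+ 2 = k%:R * (k%:R - 1) :> R.
    case: (k) => [|m]; first by rewrite bin0n mul0r mul0rn.
    by rewrite -mulr_natl -natrM -(mul_bin_diag m.+1) bin1 natrM -natr1 addrK.
  have : k.+1%:R <= n%:R :> R.
    by rewrite ler_nat ltnW // (leq_trans k_lt) // cG leq_pred.
  rewrite -natr1 in le_k lt_k *; rewrite mulr2n in bin2R => le_kn.
  have : (c * n%:R) ^+ 2 <= (k%:R + 2) ^+ 2.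
    by rewrite ler_pXn2r ?nnegrE ?mulr_ge0 ?addr_ge0 ?(ltW hc0) //; lra.
  rewrite exprMn; nra.
apply: le_trans (Pr_diam_Cay_neq2 R abelG k_lt) _; rewrite cG.
set x := c ^+ 2 / 4 * n%:R.
have n_le : n%:R <= 4 / c ^+ 2 * expR x.
  have -> : n%:R = 4 / c ^+ 2 * x by rewrite /x; field; rewrite gt_eqF.
  rewrite ler_pM2l ?divr_gt0 //; apply: le_trans (expR_ge1Dx x).
  by rewrite lerDr.
have -> : 4 / c ^+ 2 * expR 3 * expR (- (c ^+ 2 / 4) * n%:R) =
    4 / c ^+ 2 * expR x * expR (3 - (x + x)).
  by rewrite -!mulrA -!expRD /x; congr (_ * (_ * expR _)); ring.
apply: ler_pM => //; rewrite ?expR_ge0 // ler_expR.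
rewrite /x; lra.
Qed.
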